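(* Let $m,n\geq 1$ be integers and let $A\in\mathbb{R}^{m\times n}$. Then $A$ satisfies the variation diminishing property $$S^+(A\mathbf{x})\leq S^-(\mathbf{x})\quad\text{for all } \mathbf{x}\in\mathbb{R}^n \text{ with } \mathbf{x}\neq\mathbf{0}$$ if and only if $A$ is strictly sign regular (SSR).
   Context: Sign changes: for $\mathbf{x}=(x_1,\ldots,x_n)^T\in\mathbb{R}^n$, $S^-(\mathbf{x})$ is the number of sign changes in the sequence $x_1,\ldots,x_n$ after discarding all zero entries, with $S^-(\mathbf{0}):=0$. For $\mathbf{x}\ne\mathbf{0}$, $S^+(\mathbf{x})$ is the maximum possible number of sign changes in the sequence obtained by assigning to each zero entry of $\mathbf{x}$ a value $1$ or $-1$; and $S^+(\mathbf{0}):=n$ for $\mathbf{0}\in\mathbb{R}^n$ (so for $\mathbf{0}\in\mathbb{R}^m$ the value is $m$). Strict sign regularity: a real $m\times n$ matrix $A$ is strictly sign regular (SSR) if there exists a sequence of signs $\epsilon_r\in\{1,-1\}$, $1\leq r\leq\min\{m,n\}$, such that for each such $r$ every $r\times r$ minor of $A$ is non-zero and has sign $\epsilon_r$. (Minors are determinants of square submatrices with rows $i_1<\cdots<i_r$ and columns $j_1<\cdots<j_r$ taken in increasing order.) *)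

(* Defs.v *)
From mathcomp Require Import all_boot all_order all_algebra.
From mathcomp Require Import reals.

Set Implicit Arguments.
Unset Strict Implicit.
Unset Printing Implicit Defensive.

Import Order.TTheory GRing.Theory Num.Theory.
Local Open Scope ring_scope.

(* Counts adjacent entries of opposite strict signs, so it is only meant for
   sequences without zero entries. *)
Definition sign_changes (R : realType) (s : seq R) : nat :=
  (\sum_(i < (size s).-1) (s`_i * s`_i.+1 < 0)%R)%N.

(* At x = 0 the filtered sequence is empty, which gives S_minus 0 = 0. *)
Definition S_minus (R : realType) (n : nat) (x : 'cV[R]_n) : nat :=
  sign_changes [seq c <- [seq x i 0 | i <- enum 'I_n] | c != 0].

(* The bit e i selects the sign (-1) ^+ e i given to a zero entry x i 0; it is
   ignored at the nonzero entries. *)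
Definition fill_zeros (R : realType) (n : nat) (x : 'cV[R]_n)
    (e : {ffun 'I_n -> bool}) : seq R :=
  [seq (if x i 0 == 0 then (-1) ^+ e i else x i 0) | i <- enum 'I_n].

Definition S_plus (R : realType) (n : nat) (x : 'cV[R]_n) : nat :=
  if x == 0 then n
  else (\max_(e : {ffun 'I_n -> bool}) sign_changes (fill_zeros x e))%N.

(* The minors of order r are indexed by strictly increasing maps f and g, which
   list the chosen rows and columns in increasing order. *)
Definition strictly_sign_regular (R : realType) (m n : nat)
    (A : 'M[R]_(m, n)) : Prop :=
  exists eps : nat -> R,
    forall r : nat, (1 <= r <= minn m n)%N ->
      (eps r = 1 \/ eps r = -1) /\
      forall (f : 'I_r -> 'I_m) (g : 'I_r -> 'I_n),
        {homo f : i j / (i < j)%N} -> {homo g : i j / (i < j)%N} ->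
        \det (mxsub f g A) != 0 /\ Num.sg (\det (mxsub f g A)) = eps r.

(* Main.v *)
(** If A is strictly sign regular and x has p sign changes, merge the columns of A
along the p+1 runs of constant sign of x, weighted by the |x_j|.  The (p+1)-minors
of the merged matrix V are positive combinations of (p+1)-minors of A, hence all
of the same strict sign, and A x is an alternating combination of the columns of
V.  If S^+(A x) > p, then p+2 entries of A x alternate weakly; expanding the
singular matrix [A x | V] on those rows along its first column gives a vanishing
sum of terms of the same sign, so these entries of A x all vanish, against the
invertibility of the square submatrices of V.

Conversely, a vanishing r-minor yields an x supported on r columns with A x
vanishing on r rows, so that S^+(A x) >= r > S^-(x).  By Cramer's rule, changing
one row index or one column index of an r-minor without crossing the other ones
cannot change its sign, and such moves lead from any minor to the initial one. *)

Require Import Defs.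
From mathcomp Require Import all_boot all_order all_algebra.
From mathcomp Require Import reals.

Import Order.TTheory GRing.Theory Num.Theory.

Set Implicit Arguments.
Unset Strict Implicit.
Unset Printing Implicit Defensive.

Local Open Scope ring_scope.

(** * Sign changes, runs of constant sign, and weakly alternating entries *)

Section SignChanges.
Variable R : realType.
Implicit Types z : seq R.

(** When [z] has no zero entry and [i < size z], this numbers, from 0 on, the run of constant sign
    that contains the index [i]. *)
Definition changes_upto z (i : nat) : nat :=
  (\sum_(j < i) (z`_j * z`_j.+1 < 0)%R)%N.

Lemma changes_uptoS z i :
  changes_upto z i.+1 = (changes_upto z i + (z`_i * z`_i.+1 < 0)%R)%N.
Proof. by rewrite /changes_upto big_ord_recr. Qed.

Lemma changes_upto_le z i j :
  (i <= j)%N -> (changes_upto z i <= changes_upto z j)%N.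
Proof.
elim: j => [|j IH]; first by rewrite leqn0 => /eqP ->.
rewrite leq_eqVlt => /predU1P[-> //|]; rewrite ltnS => /IH.
by rewrite changes_uptoS => /leq_trans; apply; rewrite leq_addr.
Qed.

(** Discrete intermediate value property: the count starts at 0 and rises by at most one at each
    step. *)
Lemma changes_upto_hit z l t :
  (t <= changes_upto z l)%N -> exists2 i, (i <= l)%N & changes_upto z i = t.
Proof.
elim: l => [|l IH]; first by rewrite /changes_upto big_ord0 leqn0 => /eqP ->;
  exists 0; rewrite ?big_ord0.
case: (leqP t (changes_upto z l)) => [/IH[i le_il <-] _|lt_t le_t].
  by exists i => //; apply: leqW.
exists l.+1 => //; apply/eqP; rewrite eqn_leq le_t andbT.
by rewrite changes_uptoS (leq_trans _ lt_t) // -[leqRHS]addn1 leq_add2l leq_b1.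
Qed.

Lemma sg_changes_upto z i :
    (forall j, (j < size z)%N -> z`_j != 0) -> (i < size z)%N ->
  Num.sg z`_i = Num.sg z`_0 * (-1) ^+ changes_upto z i.
Proof.
move=> nz; elim: i => [|i IH] lt_i; first by rewrite /changes_upto big_ord0 mulr1.
have := IH (ltnW lt_i); rewrite changes_uptoS exprD mulrA => <-.
have := nz _ lt_i; have := nz _ (ltnW lt_i).
case: ltrP; rewrite ?expr1 ?expr0 => Hs.
  case: (ltrgt0P z`_i) => // Hi _; case: (ltrgt0P z`_i.+1) => // Hj _;
    rewrite ?(gtr0_sg Hi) ?(gtr0_sg Hj) ?(ltr0_sg Hi) ?(ltr0_sg Hj) ?mulN1r ?mul1r ?opprK //.
  - by move: Hs; rewrite ltNge ltW // mulr_gt0.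
  - by move: Hs; rewrite ltNge ltW // nmulr_rgt0.
case: (ltrgt0P z`_i) => // Hi _; case: (ltrgt0P z`_i.+1) => // Hj _;
    rewrite ?(gtr0_sg Hi) ?(gtr0_sg Hj) ?(ltr0_sg Hi) ?(ltr0_sg Hj) ?mulr1 //.
- by move: Hs; rewrite leNgt nmulr_llt0 ?Hi.
- by move: Hs; rewrite leNgt nmulr_rlt0 ?Hj.
Qed.

Lemma sign_changesE z : sign_changes z = changes_upto z (size z).-1.
Proof. by []. Qed.

Lemma ltn_size_pred z i : (i < size z)%N -> (i <= (size z).-1)%N.
Proof. by case: (size z). Qed.

Lemma sorted_ltn_enum_ord n : sorted ltn (map val (enum 'I_n)).
Proof. by rewrite val_enum_ord iota_ltn_sorted. Qed.

(* [b] numbers the maximal runs of constant sign of [x], from 0 on; its values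
   at the zero entries are irrelevant. *)
Lemma S_minus_blocks n (x : 'cV[R]_n) : x != 0 ->
  exists (b : 'I_n -> nat) (s : R),
    [/\ s != 0 /\ forall i, x i 0 = s * (-1) ^+ b i * `|x i 0|,
        forall i j, x i 0 != 0 -> x j 0 != 0 -> (i <= j)%N -> (b i <= b j)%N,
        forall t, (t <= S_minus x)%N -> exists2 i, x i 0 != 0 & b i = t
      & forall i, x i 0 != 0 -> (b i <= S_minus x)%N].
Proof.
move=> nzx; set J := [seq i <- enum 'I_n | x i 0 != 0].
set z := [seq x i 0 | i <- J].
have Ez : [seq c <- [seq x i 0 | i <- enum 'I_n] | c != 0] = z.
  by rewrite filter_map.
have memJ i : (i \in J) = (x i 0 != 0) by rewrite mem_filter mem_enum andbT.
have szJ : (0 < size J)%N.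
  rewrite lt0n size_eq0; apply: contra nzx => /eqP J0; apply/eqP/colP => i.
  by rewrite mxE; apply/eqP; move: (memJ i); rewrite J0 in_nil => /esym/negbFE.
have [i0 i0J] : exists i0, i0 \in J.
  by case: (J) szJ => // i0 J' _; exists i0; rewrite inE eqxx.
have szz : size z = size J by rewrite size_map.
have zi i : i \in J -> z`_(index i J) = x i 0.
  by move=> iJ; rewrite (nth_map i0) ?index_mem // nth_index.
have nz j : (j < size z)%N -> z`_j != 0.
  rewrite szz => jJ; rewrite (nth_map i0) //.
  by rewrite -memJ mem_nth.
have srt : sorted (relpre val ltn) J.
  rewrite sorted_filter //; first by move=> ? ? ?; apply: ltn_trans.
  by rewrite -sorted_map sorted_ltn_enum_ord.
pose b i := changes_upto z (index i J).
have Sm : S_minus x = changes_upto z (size z).-1 by rewrite /S_minus Ez.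
exists b, (Num.sg z`_0); split.
- rewrite sgr_eq0 nz ?szz //; split=> // i; have [->|] := eqVneq (x i 0) 0.
    by rewrite normr0 mulr0.
  rewrite -memJ => iJ; rewrite -(sg_changes_upto nz) ?szz ?index_mem //.
  by rewrite zi // -numEsg.
- move=> i j; rewrite -!memJ => iJ jJ le_ij; apply: changes_upto_le.
  rewrite leqNgt; apply/negP => lt_ji; move: le_ij; rewrite leqNgt => /negP; apply.
  have tr : transitive (relpre (@nat_of_ord n) ltn).
    by move=> ? ? ?; apply: ltn_trans.
  have := sorted_ltn_nth tr i0 srt (index j J) (index i J).
  by rewrite !inE !index_mem !nth_index //; apply.
- move=> t; rewrite Sm => /changes_upto_hit[l le_l <-].
  have lJ : (l < size J)%N.
    by move: le_l; rewrite szz; case: (size J) szJ => //= k _; rewrite ltnS.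
  exists (nth i0 J l); first by rewrite -memJ mem_nth.
  by rewrite /b index_uniq // filter_uniq // enum_uniq.
- move=> i; rewrite -memJ Sm => iJ; apply: changes_upto_le.
  by apply: ltn_size_pred; rewrite szz index_mem.
Qed.

Section Fill.
Variables (n : nat) (x : 'cV[R]_n) (e : {ffun 'I_n -> bool}).

Lemma size_fill_zeros : size (fill_zeros x e) = n.
Proof. by rewrite size_map size_enum_ord. Qed.

Lemma nth_fill_zeros (i : 'I_n) :
  (fill_zeros x e)`_i = if x i 0 == 0 then (-1) ^+ e i else x i 0.
Proof. by rewrite (nth_map i) ?size_enum_ord // nth_ord_enum. Qed.

Lemma fill_zeros_neq0 j : (j < size (fill_zeros x e))%N -> (fill_zeros x e)`_j != 0.
Proof.
rewrite size_fill_zeros => lt_j; rewrite (nth_fill_zeros (Ordinal lt_j)).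
by case: ifP => [_|/negbT //]; rewrite signr_eq0.
Qed.

End Fill.

(** For [i] in [H], the position of [i] in the increasing listing of [H]; thus [(-1) ^+ rank_in H i]
    alternates along [H]. *)
Definition rank_in n (H : {set 'I_n}) (i : 'I_n) := #|[set j in H | j < i]%N|.

Lemma rank_in_next n (H : {set 'I_n}) (i j : 'I_n) : i \in H -> (i < j)%N ->
  (forall l, l \in H -> (l < j)%N -> (l <= i)%N) ->
  rank_in H j = (rank_in H i).+1.
Proof.
move=> iH lt_ij maxi; rewrite /rank_in.
have -> : [set l in H | l < j]%N = i |: [set l in H | l < i]%N.
  apply/setP => l; rewrite !inE; have [->|ne] := eqVneq l i; first by rewrite iH.
  apply: andb_id2l => lH; apply/idP/idP => [/(maxi l lH)|/ltn_trans]; last exact.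
  by rewrite leq_eqVlt => /predU1P[/val_inj/eqP|]; rewrite ?(negPf ne).
by rewrite cardsU1 !inE ltnn andbF.
Qed.

(** The zero entries on [H] can be filled with the signs that the alternation asks for. Consecutive
    elements of [H] then carry opposite strict signs, which forces a sign change between them. *)
Lemma S_plus_ge_alternating m (y : 'cV[R]_m) (H : {set 'I_m}) (s : R) :
    y != 0 -> s != 0 ->
    (forall i, i \in H -> 0 <= s * (-1) ^+ rank_in H i * y i 0) ->
  (#|H| <= (S_plus y).+1)%N.
Proof.
move=> nzy nzs Hs; have [->|[i1 i1H]] := set_0Vmem H; first by rewrite cards0.
pose e : {ffun 'I_m -> bool} := [ffun i => (s < 0) (+) odd (rank_in H i)].
pose z := fill_zeros y e.
have sgz i : i \in H -> Num.sg z`_i = Num.sg s * (-1) ^+ rank_in H i.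
  move=> iH; rewrite nth_fill_zeros; have := Hs i iH.
  case: eqVneq => [_ _|nzi].
    rewrite ffunE signr_addb signr_odd sgrM !sgrX sgrN1 neqr0_sign ?sgr_id //.
  have nzp : s * (-1) ^+ rank_in H i != 0 by rewrite mulf_neq0 ?signr_eq0.
  rewrite le_eqVlt eq_sym mulf_eq0 (negPf nzp) (negPf nzi) /=.
  rewrite -sgr_cp0 sgrM mulr_sg_eq1 => /andP[_ /eqP <-].
  by rewrite sgrM sgrX sgrN1.
have nz := @fill_zeros_neq0 m y e; rewrite -/z in nz.
have szz : size z = m by rewrite size_fill_zeros.
(* Strong induction along [H]: the predecessor [l] of [i] in [H] has the opposite sign in [z], so
   the counts at [l] and [i] differ. *)
have rank_le i : i \in H -> (rank_in H i <= changes_upto z i)%N.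
  have [N] := ubnP (i : nat); elim: N i => // N IH i lt_iN iH.
  have [l0 l0P|noH] := pickP [pred l in H | l < i]%N; last first.
    by rewrite /rank_in eq_card0 // => l; have := noH l; rewrite !inE.
  case: (arg_maxnP (fun l : 'I_m => l : nat) l0P) => l /andP[lH lt_li] maxl.
  have rk : rank_in H i = (rank_in H l).+1.
    by apply: rank_in_next => // j jH lt_ji; apply: maxl; rewrite inE jH.
  have := IH l (leq_trans lt_li lt_iN) lH; rewrite rk => le_l.
  apply: leq_ltn_trans le_l _.
  have := changes_upto_le z (ltnW lt_li); rewrite leq_eqVlt => /predU1P[eqc|//].
  have El := sgz l lH; have Ei := sgz i iH.
  rewrite (sg_changes_upto nz) ?szz // in El; rewrite (sg_changes_upto nz) ?szz // in Ei.
  move: Ei; rewrite rk -eqc El exprS mulN1r mulrN => /eqP.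
  rewrite -subr_eq0 opprK -mulr2n mulrn_eq0 /= mulf_eq0 sgr_eq0.
  by rewrite (negPf nzs) signr_eq0.
case: (arg_maxnP (fun l : 'I_m => l : nat) (i1H : (fun i => i \in H) i1)) => l lH maxl.
have -> : #|H| = (rank_in H l).+1.
  rewrite /rank_in (cardsD1 l) lH add1n; congr _.+1; apply: eq_card => j.
  rewrite !inE ltn_neqAle andbC; apply: andb_id2l => jH.
  by have /= -> := maxl j jH; rewrite andbT.
rewrite ltnS; apply: leq_trans (rank_le l lH) _.
rewrite /S_plus (negPf nzy); apply: leq_trans (leq_bigmax e).
by rewrite sign_changesE -/z; apply: changes_upto_le; apply: ltn_size_pred; rewrite szz.
Qed.

(** If [y] is nonzero, one nonzero entry joined to the [r] zeros gives [r + 1] weakly alternating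
    entries. If [y = 0], the convention for [S_plus] gives [m], which is at least [r]. *)
Lemma S_plus_ge_zeros m r (y : 'cV[R]_m) (f : 'I_r -> 'I_m) :
  injective f -> (forall t, y (f t) 0 = 0) -> (r <= S_plus y)%N.
Proof.
move=> injf y0; have cf : #|[set f t | t : 'I_r]| = r by rewrite card_imset ?card_ord.
have [y00|nzy] := eqVneq y 0.
  by rewrite /S_plus y00 eqxx -[in X in (X <= _)%N]cf -[leqRHS](card_ord m) max_card.
have [i nzi] : exists i, y i 0 != 0.
  apply/existsP; rewrite -negb_forall; apply: contra nzy => /forallP y00.
  by apply/eqP/colP => i; rewrite mxE; apply/eqP.
pose H := i |: [set f t | t : 'I_r].
have iH : i \notin [set f t | t : 'I_r].
  by apply/imsetP => -[t _ Et]; rewrite Et y0 eqxx in nzi.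
have <- : #|H|.-1 = r by rewrite cardsU1 iH cf.
pose s := (-1) ^+ rank_in H i * y i 0.
suff : (#|H| <= (S_plus y).+1)%N by case: #|H|.
apply: (@S_plus_ge_alternating _ _ _ s) => //.
  by rewrite mulf_neq0 ?signr_eq0.
move=> j /setU1P[->|/imsetP[t _ ->]]; last by rewrite y0 mulr0.
by rewrite -mulrA -/s -expr2 sqr_ge0.
Qed.

(** Take a filling that attains the maximum and one index in each of its first [k + 1] runs. Its
    strict alternation becomes weak on [y], where the filled entries are zero. *)
Lemma S_plus_alternating m (y : 'cV[R]_m) k : y != 0 -> (k <= S_plus y)%N ->
  exists (h : 'I_k.+1 -> 'I_m) (s : R),
    [/\ {homo h : i j / (i < j)%N}, s != 0
      & forall t : 'I_k.+1, 0 <= s * (-1) ^+ t * y (h t) 0].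
Proof.
move=> nzy; rewrite /S_plus (negPf nzy).
have [e ->] : {e : {ffun 'I_m -> bool} | (\max_e sign_changes (fill_zeros y e))%N
    = sign_changes (fill_zeros y e)}.
  by apply: bigop.eq_bigmax; apply/card_gt0P; exists [ffun=> true].
set z := fill_zeros y e; have nz := @fill_zeros_neq0 m y e; rewrite -/z in nz.
have szz : size z = m by rewrite size_fill_zeros.
rewrite sign_changesE => le_k.
have m_gt0 : (0 < m)%N.
  rewrite lt0n; apply: contra nzy => /eqP m0; apply/eqP/colP => i.
  by have := ltn_ord i; rewrite {2}m0.
have /fin_all_exists[h hP] (t : 'I_k.+1) : exists i : 'I_m, changes_upto z i = t.
  have /changes_upto_hit[i le_i ct] : (t <= changes_upto z (size z).-1)%N.
    by apply: leq_trans le_k; rewrite -ltnS.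
  have lt_i : (i < m)%N by rewrite -(prednK m_gt0) ltnS -szz.
  by exists (Ordinal lt_i).
exists h, (Num.sg z`_0); split.
- move=> t t' lt_t; rewrite ltnNge; apply/negP => /(changes_upto_le z).
  by rewrite !hP leqNgt lt_t.
- by rewrite sgr_eq0 nz ?szz.
- move=> t; rewrite -(hP t) -(sg_changes_upto nz) ?szz //.
  rewrite /z nth_fill_zeros; case: eqP => [->|_]; first by rewrite mulr0.
  by rewrite -normrEsg normr_ge0.
Qed.

End SignChanges.

(** * Determinants, vectors supported on chosen columns, and increasing index maps *)

Lemma covered_ltn r p (u : 'I_r -> nat) :
  (forall t, (t <= p)%N -> exists j, u j = t) -> (p < r)%N.
Proof.
move=> hit; have /fin_all_exists[v uv] (t : 'I_p.+1) : exists j, u j = t.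
  by apply: hit; rewrite -ltnS.
have injv : injective v.
  by move=> t t' Ev; apply: val_inj; rewrite /= -!uv Ev.
by have := leq_card v injv; rewrite !card_ord.
Qed.

Lemma homo_ltn_inj r m (f : 'I_r -> 'I_m) :
  {homo f : i j / (i < j)%N} -> injective f.
Proof.
move=> incf i j Ef; apply/val_inj/eqP; rewrite eqn_leq.
by apply/andP; split; rewrite leqNgt; apply/negP => /incf; rewrite Ef ltnn.
Qed.

(** The Cauchy-Binet formula before grouping: multilinearity in the rows of the product, summed over
    all maps [g] rather than over increasing ones. *)
Lemma det_mulmx_rows (R : comNzRingType) k n (C : 'M[R]_(k, n)) (B : 'M[R]_(n, k)) :
  \det (C *m B) =
  \sum_(g : {ffun 'I_k -> 'I_n}) (\prod_t C t (g t)) * \det (rowsub g B).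
Proof.
rewrite /determinant; under eq_bigr => s _.
  under eq_bigr => t _ do rewrite mxE.
  rewrite bigA_distr_bigA big_distrr /=; over.
rewrite exchange_big /=; apply: eq_bigr => g _; rewrite big_distrr /=.
apply: eq_bigr => s _; rewrite big_split /= mulrCA.
by congr (_ * (_ * _)); apply: eq_bigr => t _; rewrite mxE.
Qed.

Lemma det_neq0_mulmx_eq0 (R : fieldType) k (M : 'M[R]_k) (u : 'cV_k) :
  \det M != 0 -> M *m u = 0 -> u = 0.
Proof.
move=> nzM Mu; have uM : M \in unitmx by rewrite unitmxE unitfE.
by rewrite -(mulKmx uM u) Mu mulmx0.
Qed.

(* Expansion of the determinant of the singular matrix [V *m u | V] along its
   first column. *)
Lemma sum_minors_colspan (R : fieldType) k (V : 'M[R]_(k.+1, k)) (u : 'cV_k) :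
  \sum_(a < k.+1) (-1) ^+ a * (V *m u) a 0 * \det (row' a V) = 0.
Proof.
pose M : 'M_(1 + k) := row_mx (V *m u) V.
have : \det M = 0.
  rewrite -det_tr; apply/eqP/det0P; exists (col_mx (-1)%:M u)^T.
    rewrite trmx_eq0 col_mx_eq0 negb_and -scalemx1 scaler_eq0 oppr_eq0 oner_eq0.
    by rewrite matrix_nonzero1.
  by rewrite -trmx_mul mul_row_col mul_mx_scalar scaleN1r addNr trmx0.
rewrite (expand_det_col M 0) => detM; rewrite -[RHS]detM.
apply: eq_bigr => a _; rewrite /cofactor addn0 mulrCA -mulrA.
congr (_ * (_ * _)).
  have -> : (0 : 'I_(1 + k)) = lshift k 0 by apply: val_inj.
  by rewrite row_mxEl.
congr (\det _); apply/matrixP => i j; rewrite mxE [in RHS]mxE [in RHS]mxE.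
have -> : lift 0 j = rshift 1 j by apply: val_inj.
by rewrite row_mxEr.
Qed.

Lemma cofactor_row_irrelevant (R : comNzRingType) r (M M' : 'M[R]_r) k j :
  (forall i l, i != k -> M i l = M' i l) -> cofactor M k j = cofactor M' k j.
Proof.
move=> eqM; congr (_ * \det _); apply/matrixP => i l; rewrite !mxE.
by rewrite eqM // eq_sym neq_lift.
Qed.

Lemma cofactor_col_irrelevant (R : comNzRingType) r (M M' : 'M[R]_r) i k :
  (forall j l, l != k -> M j l = M' j l) -> cofactor M i k = cofactor M' i k.
Proof.
move=> eqM; congr (_ * \det _); apply/matrixP => j l; rewrite !mxE.
by rewrite eqM // eq_sym neq_lift.
Qed.

Section ColumnEmbedding.
Variables (R : comNzRingType) (n r : nat) (g : 'I_r -> 'I_n) (c : 'cV[R]_r).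

(** The vector [colsub g 1%:M *m c] places the coefficients [c] at the positions [g] and is zero
    elsewhere. *)
Lemma mulmx_colsub1 m (A : 'M[R]_(m, n)) :
  A *m (colsub g 1%:M *m c) = colsub g A *m c.
Proof. by rewrite mulmxA (mulmx_colsub g) mulmx1. Qed.

Lemma colsub1_mulmx i :
  (colsub g 1%:M *m c) i 0 = \sum_(t | i == g t) c t 0.
Proof.
rewrite mxE [RHS]big_mkcond; apply: eq_bigr => t _.
by rewrite !mxE; case: eqP; rewrite ?mul1r ?mul0r.
Qed.

Lemma colsub1_mulmx_in t :
  injective g -> (colsub g 1%:M *m c) (g t) 0 = c t 0.
Proof.
move=> injg; rewrite colsub1_mulmx (big_pred1 t) // => t'.
by rewrite /= (inj_eq injg) eq_sym.
Qed.

Lemma colsub1_mulmx_out i :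
  (colsub g 1%:M *m c) i 0 != 0 -> exists t, i = g t.
Proof.
rewrite colsub1_mulmx; have [t /eqP ->|no] := pickP (fun t => i == g t).
  by exists t.
by rewrite big_pred0 ?eqxx.
Qed.

End ColumnEmbedding.

Lemma sgr_eq_of_nlt0 (R : realDomainType) (a b : R) :
  a != 0 -> b != 0 -> ~ (a * b < 0) -> Num.sg a = Num.sg b.
Proof.
move=> nza nzb /negP; rewrite -leNgt le_eqVlt eq_sym mulf_eq0.
rewrite (negPf nza) (negPf nzb) /= -sgr_cp0 sgrM mulr_sg_eq1.
by case/andP=> _ /eqP.
Qed.

(** Induction on the sum of the values. The least [k] with [f k != k] satisfies [k < f k], and
    lowering [f k] to [k] keeps the map increasing because [f t = t] for [t < k]. *)
Lemma descend_to_initial m r (T : Type) (Q : ('I_r -> 'I_m.+1) -> T) :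
    (forall f f', f =1 f' -> Q f = Q f') ->
    (forall (f f' : 'I_r -> 'I_m.+1) k,
      {homo f : i j / (i < j)%N} -> {homo f' : i j / (i < j)%N} ->
      (forall t, t != k -> f t = f' t) -> (f' k < f k)%N -> Q f = Q f') ->
  forall f : 'I_r -> 'I_m.+1, {homo f : i j / (i < j)%N} -> Q f = Q (fun t => inord t).
Proof.
move=> Qext Qstep f.
have [N] := ubnP (\sum_t f t)%N; elim: N f => // N IH f ltN incf.
have [/forallP f_id|] := boolP [forall t, f t == t :> nat].
  apply: Qext => t; apply: val_inj; rewrite /= inordK ?(eqP (f_id t)) //.
  by rewrite -(eqP (f_id t)).
rewrite negb_forall => /existsP[t0 nt0].
have [k nk mink] := @arg_minnP _ t0 (fun t => f t != t :> nat) (@nat_of_ord r) nt0.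
have idlt (t : 'I_r) : (t < k)%N -> f t = t :> nat.
  by move=> lt_t; apply: contraTeq lt_t => /mink; rewrite -leqNgt.
have ge_id (t : 'I_r) : (t <= f t)%N.
  case: t => t; elim: t => // t IHt lt_t.
  apply: leq_ltn_trans (IHt (ltnW lt_t)) _; exact: incf.
have ltk : (k < f k)%N by rewrite ltn_neqAle eq_sym nk ge_id.
pose f' (t : 'I_r) := if t == k then inord k else f t.
have f'k : f' k = k :> nat.
  by rewrite /f' eqxx inordK // (ltn_trans ltk).
have f'N (t : 'I_r) : t != k -> f t = f' t by rewrite /f' => /negPf->.
have incf' : {homo f' : i j / (i < j)%N}.
  move=> i j lt_ij; have [ik|ni] := eqVneq i k.
    rewrite ik f'k -f'N; first by apply: ltn_trans ltk _; apply: incf; rewrite -ik.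
    by rewrite -ik; apply: contraTneq lt_ij => ->; rewrite ltnn.
  have [jk|nj] := eqVneq j k; last by rewrite -!f'N //; apply: incf.
  by rewrite jk f'k -f'N // idlt -?jk.
rewrite (Qstep f f' k) ?f'k //; apply: IH => //.
rewrite -ltnS; apply: leq_trans _ ltN.
rewrite ltnS (bigD1 k) //= [X in (_ < X)%N](bigD1 k) //= f'k.
rewrite (eq_bigr (fun t => f t : nat)) ?ltn_add2r // => t nt.
by rewrite -f'N.
Qed.

(** * Strict sign regularity implies variation diminution *)

Section SSRToVD.
Variables (R : realType) (m n : nat) (A : 'M[R]_(m, n)).

(** In the ungrouped expansion of the transposed product, a term survives only if [g t] lies in
    block [t] for every [t], which makes [g] increasing. All terms are then nonnegative after
    multiplication by [eps], and choosing one column of nonzero weight in each block gives a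
    positive one. *)
Lemma det_merged_columns_gt0 p (eps : R) (w : 'I_n -> R) (b : 'I_n -> nat)
    (f : 'I_p.+1 -> 'I_m) :
    (forall g : 'I_p.+1 -> 'I_n, {homo g : i j / (i < j)%N} ->
       0 < eps * \det (mxsub f g A)) ->
    (forall j, 0 <= w j) ->
    (forall i j, w i != 0 -> w j != 0 -> (i <= j)%N -> (b i <= b j)%N) ->
    (forall t, (t <= p)%N -> exists2 i, w i != 0 & b i = t) ->
  0 < eps * \det (rowsub f (A *m \matrix_(j, t) ((b j == t)%:R * w j))).
Proof.
move=> posA w_ge0 mono_b hit_b.
rewrite -mul_rowsub_mx -det_tr trmx_mul det_mulmx_rows big_distrr /=.
set C := (\matrix_(j, t) _)^T.
have C_ge0 t j : 0 <= C t j by rewrite !mxE mulr_ge0 ?ler0n.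
have CP t j : C t j != 0 -> (w j != 0) * (b j = t).
  by rewrite !mxE mulf_eq0 negb_or pnatr_eq0 eqb0 negbK => /andP[/eqP-> ->].
have detE (g : 'I_p.+1 -> 'I_n) :
    \det (rowsub g (rowsub f A)^T) = \det (mxsub f g A).
  by rewrite -[RHS]det_tr; congr (\det _); apply/matrixP => i j; rewrite !mxE.
have homo_g (g : 'I_p.+1 -> 'I_n) :
    (forall t, C t (g t) != 0) -> {homo g : i j / (i < j)%N}.
  move=> nzC i j lt_ij; rewrite ltnNge; apply/negP => le_ji.
  have [[wi bi] [wj bj]] := (CP _ _ (nzC i), CP _ _ (nzC j)).
  by have := mono_b _ _ wj wi le_ji; rewrite bi bj leqNgt lt_ij.
have /fin_all_exists2[g0 nz0 b0] (t : 'I_p.+1) : exists2 i, w i != 0 & b i = t.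
  by apply: hit_b; rewrite -ltnS.
have C0 t : 0 < C t ([ffun t => g0 t] t).
  by rewrite !mxE ffunE b0 eqxx mul1r lt0r nz0 w_ge0.
rewrite (bigD1 [ffun t => g0 t]) //= ltr_wpDr //.
  rewrite sumr_ge0 // => g _; rewrite mulrCA.
  have [/forallP nzC|] := boolP [forall t, C t (g t) != 0].
    by rewrite detE mulr_ge0 ?prodr_ge0 // ltW // posA //; apply: homo_g.
  rewrite negb_forall => /existsP[t]; rewrite negbK => /eqP C00.
  by rewrite (bigD1 t) //= C00 !mul0r.
rewrite mulrCA detE mulr_gt0 ?prodr_gt0 // posA //.
by apply: homo_g => t; rewrite gt_eqF.
Qed.

Lemma ssr_variation_diminishing : strictly_sign_regular A ->
  forall x : 'cV[R]_n, x <> 0 -> (S_plus (A *m x) <= S_minus x)%N.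
Proof.
move=> [eps ssrA] x /eqP nzx; rewrite leqNgt; apply/negP => Hgt.
have [b [s [[nzs xE] mono_b hit_b le_b]]] := S_minus_blocks nzx.
set p := S_minus x in Hgt hit_b le_b.
pose C : 'M[R]_(n, p.+1) := \matrix_(j, t) ((b j == t)%:R * `|x j 0|).
pose V := A *m C.
pose u : 'cV[R]_p.+1 := \col_t (s * (-1) ^+ t).
have le_pn : (p < n)%N.
  by apply: (@covered_ltn _ _ b) => t /hit_b[i _ <-]; exists i.
have posV (f : 'I_p.+1 -> 'I_m) : {homo f : i j / (i < j)%N} ->
    0 < eps p.+1 * \det (rowsub f V).
  move=> incf; have le_pm : (p < m)%N.
    by have := leq_card f (homo_ltn_inj incf); rewrite !card_ord.
  have [|epsP minorsP] := ssrA p.+1; first by rewrite leq_min le_pm le_pn.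
  apply: det_merged_columns_gt0 => // [g incg|i j|t /hit_b[i nzi bi]].
  - by have [nzD <-] := minorsP f g incf incg; rewrite -normrEsg normr_gt0.
  - by rewrite !normr_eq0; apply: mono_b.
  - by exists i; rewrite ?normr_eq0.
have nzV (f : 'I_p.+1 -> 'I_m) : {homo f : i j / (i < j)%N} -> \det (rowsub f V) != 0.
  by move=> /posV/lt0r_neq0; rewrite mulf_eq0 negb_or => /andP[].
have uxE : C *m u = x.
  apply/colP => j; rewrite mxE; have [xj0|nzj] := eqVneq (x j 0) 0.
    by rewrite xj0 big1 // => t _; rewrite !mxE xj0 normr0 mulr0 mul0r.
  have lt_b : (b j < p.+1)%N by rewrite ltnS le_b.
  rewrite (bigD1 (Ordinal lt_b)) //= big1 => [|t ne_t].
    by rewrite !mxE /= eqxx mul1r addr0 mulrC -xE.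
  by rewrite !mxE eq_sym (_ : (t == b j :> nat) = false) ?mul0r //; apply: negPf.
have nzu : u <> 0.
  by move=> /colP/(_ 0); rewrite !mxE mulr1 => s0; rewrite s0 eqxx in nzs.
have yE : A *m x = V *m u by rewrite -uxE mulmxA.
have [y0|nzy] := eqVneq (A *m x) 0.
  (* Here [S_plus (A *m x) = m], so [p < m] and the first [p + 1] rows of [V] form an invertible
     matrix that annihilates [u]. *)
  move: Hgt; rewrite /S_plus y0 eqxx => le_pm.
  apply/nzu/(@det_neq0_mulmx_eq0 _ _ (rowsub (widen_ord le_pm) V)).
    exact: nzV.
  by rewrite mul_rowsub_mx -yE y0; apply/matrixP => i j; rewrite !mxE.
have [h [s' [inch nzs' alt]]] := S_plus_alternating nzy Hgt.
have inc_lift (a : 'I_p.+2) : {homo h \o lift a : i j / (i < j)%N}.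
  by move=> i j lt_ij; apply: inch; rewrite /= ltnNge leq_bump2 -ltnNge.
have row'E (a : 'I_p.+2) : row' a (rowsub h V) = rowsub (h \o lift a) V.
  by apply/matrixP => i j; rewrite !mxE.
(* Multiplied by [s' * eps p.+1], every term of the vanishing expansion is nonnegative, hence zero;
   its minor is nonzero, so the entry vanishes. *)
have y0 a : (A *m x) (h a) 0 = 0.
  have := sum_minors_colspan (rowsub h V) u.
  move/(congr1 ( *%R (s' * eps p.+1))); rewrite mulr0 big_distrr /=.
  have termE (c : 'I_p.+2) : s' * eps p.+1 * ((-1) ^+ c * (rowsub h V *m u) c 0 *
        \det (row' c (rowsub h V))) =
      s' * (-1) ^+ c * (A *m x) (h c) 0 *
        (eps p.+1 * \det (rowsub (h \o lift c) V)).
    by rewrite row'E mul_rowsub_mx -yE mxE mulrACA !mulrA.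
  under eq_bigr do rewrite termE.
  move/psumr_eq0P => /(_ (fun c _ => mulr_ge0 (alt c) (ltW (posV _ (inc_lift c))))).
  move/(_ a isT)/eqP; rewrite !mulf_eq0 signr_eq0 (negPf nzs') /=.
  by rewrite -mulf_eq0 (gt_eqF (posV _ (inc_lift a))) orbF => /eqP.
apply: nzu; apply: (@det_neq0_mulmx_eq0 _ _ (rowsub (h \o lift 0) V)).
  exact: nzV.
by rewrite mul_rowsub_mx -yE; apply/colP => i; rewrite mxE y0 mxE.
Qed.

End SSRToVD.

(** * Variation diminution implies strict sign regularity *)

Section VDToSSR.
Variables (R : realType) (m n : nat) (A : 'M[R]_(m, n)).
Hypothesis vdA :
  forall x : 'cV[R]_n, x != 0 -> (S_plus (A *m x) <= S_minus x)%N.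

(** Each of the [S_minus x + 1] runs contains an index of the support. *)
Lemma S_minus_support r (x : 'cV[R]_n) (g : 'I_r -> 'I_n) : x != 0 ->
  (forall i, x i 0 != 0 -> exists t, i = g t) -> (S_minus x < r)%N.
Proof.
move=> nzx supp; have [b [s [_ _ hit_b _]]] := S_minus_blocks nzx.
apply: (@covered_ltn _ _ (b \o g)) => t /hit_b[i /supp[j ->] <-].
by exists j.
Qed.

Lemma vd_minor_neq0 r (f : 'I_r -> 'I_m) (g : 'I_r -> 'I_n) :
  injective f -> injective g -> \det (mxsub f g A) != 0.
Proof.
move=> injf injg; apply/negP; rewrite -det_tr => /det0P[v nzv vM].
pose x : 'cV[R]_n := colsub g 1%:M *m v^T.
have nzx : x != 0.
  apply: contra nzv => /eqP x0; apply/eqP/rowP => t.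
  by have := colsub1_mulmx_in v^T t injg; rewrite -/x x0 !mxE.
have := S_minus_support nzx (@colsub1_mulmx_out _ _ _ g v^T).
rewrite ltnNge => /negP; apply; apply: leq_trans (vdA nzx).
apply: (S_plus_ge_zeros injf) => t.
have : mxsub f g A *m v^T = 0 by rewrite -(trmxK (mxsub f g A)) -trmx_mul vM trmx0.
move/colP/(_ t); rewrite [RHS]mxE => <-.
rewrite mulmx_colsub1 !mxE; apply: eq_bigr => j _.
by rewrite !mxE.
Qed.

(* By Cramer's rule the coefficients solving [A[f',g] c = det A[f',g] e_k]
   produce a vector [A x] that vanishes on the rows [f'] except at [f' k], and
   whose entries at [f' k] and [f k] are the two minors; opposite signs there
   would give [S^+(A x) >= r]. *)
Lemma vd_row_step r (f f' : 'I_r -> 'I_m) (g : 'I_r -> 'I_n) k :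
    {homo f : i j / (i < j)%N} -> {homo f' : i j / (i < j)%N} ->
    {homo g : i j / (i < j)%N} ->
    (forall t, t != k -> f t = f' t) -> (f' k < f k)%N ->
  Num.sg (\det (mxsub f g A)) = Num.sg (\det (mxsub f' g A)).
Proof.
move=> incf incf' incg eqf ltk.
have [[injf injf'] injg] := (homo_ltn_inj incf, homo_ltn_inj incf', homo_ltn_inj incg).
have nzD := vd_minor_neq0 injf injg; have nzD' := vd_minor_neq0 injf' injg.
set M := mxsub f g A in nzD *; set M' := mxsub f' g A in nzD' *.
apply: sgr_eq_of_nlt0 => // neg.
pose c : 'cV[R]_r := col k (\adj M').
pose x : 'cV[R]_n := colsub g 1%:M *m c.
have AxE i : (A *m x) i 0 = \sum_j A i (g j) * cofactor M' k j.
  by rewrite mulmx_colsub1 mxE; apply: eq_bigr => j _; rewrite !mxE.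
have Axf' t : (A *m x) (f' t) 0 = \det M' *+ (t == k).
  have := mul_mx_adj M' => /matrixP/(_ t k); rewrite [RHS]mxE => <-.
  by rewrite AxE mxE; apply: eq_bigr => j _; rewrite !mxE.
have Axfk : (A *m x) (f k) 0 = \det M.
  rewrite AxE (expand_det_row M k); apply: eq_bigr => j _; rewrite mxE.
  congr (_ * _); apply: cofactor_row_irrelevant => i l ne_ik.
  by rewrite !mxE eqf.
have nzAx : A *m x != 0 by apply: contra nzD => /eqP Ax0; rewrite -Axfk Ax0 mxE.
have nzx : x != 0 by apply: contra nzAx => /eqP ->; rewrite mulmx0.
have := S_minus_support nzx (@colsub1_mulmx_out _ _ _ g c).
rewrite ltnNge => /negP; apply; apply: leq_trans (vdA nzx).
have fkN : f k \notin [set f' t | t : 'I_r].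
  apply/imsetP => -[t _ Et]; have [tk|ntk] := eqVneq t k.
    by rewrite Et tk ltnn in ltk.
  by move: Et; rewrite -(eqf _ ntk) => /injf kt; rewrite kt eqxx in ntk.
pose H := f k |: [set f' t | t : 'I_r].
suff : (#|H| <= (S_plus (A *m x)).+1)%N.
  by rewrite cardsU1 fkN card_imset // card_ord.
(* The maps agree off [k] and both increase, so no row of [f'] lies strictly between [f' k] and
   [f k]: these are neighbours in [H]. *)
have rk : rank_in H (f k) = (rank_in H (f' k)).+1.
  apply: rank_in_next => //; first by rewrite !inE imset_f ?orbT.
  move=> l /setU1P[->|/imsetP[t _ ->]]; first by rewrite ltnn.
  have [->//|ntk] := eqVneq t k; move=> lt_t; rewrite leqNgt; apply/negP => lt_kt.
  have [lt_tk|] := ltnP t k.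
    by have := ltn_trans lt_kt (incf' _ _ lt_tk); rewrite ltnn.
  rewrite leq_eqVlt => /predU1P[/val_inj kt|/incf]; first by rewrite kt eqxx in ntk.
  by move/(ltn_trans lt_t); rewrite eqf // ltnn.
(* With this factor the condition reads [0 <= (\det M') ^+ 2] at [f' k] and
   [0 <= - (\det M * \det M')] at [f k]; the other entries on [H] are zero. *)
apply: (@S_plus_ge_alternating _ _ _ _ (\det M' * (-1) ^+ rank_in H (f' k))) => //.
  by rewrite mulf_neq0 ?signr_eq0.
move=> i /setU1P[->|/imsetP[t _ ->]].
  rewrite rk Axfk exprS mulN1r mulrN mulNr -(mulrA (\det M')) -expr2 sqrr_sign.
  by rewrite mulr1 oppr_ge0 mulrC ltW.
rewrite Axf'; have [->|_] := eqVneq t k; last by rewrite mulr0n mulr0.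
by rewrite mulr1n -(mulrA (\det M')) -expr2 sqrr_sign mulr1 -expr2 sqr_ge0.
Qed.

(* By Cramer's rule [A[f,g'] c = det A[f,g'] A[f,g k]] is solved by a [c] with
   [c k = det A[f,g]], which gives an [x] supported on the columns [g'] and
   [g k] with [A x] vanishing on the rows [f]; if the two minors had opposite
   signs then the adjacent entries of [x] at [g' k] and [g k] would have the
   same sign. *)
Lemma vd_col_step r (f : 'I_r -> 'I_m) (g g' : 'I_r -> 'I_n) k :
    {homo f : i j / (i < j)%N} -> {homo g : i j / (i < j)%N} ->
    {homo g' : i j / (i < j)%N} ->
    (forall t, t != k -> g t = g' t) -> (g' k < g k)%N ->
  Num.sg (\det (mxsub f g A)) = Num.sg (\det (mxsub f g' A)).
Proof.
move=> incf incg incg' eqg ltk.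
have [[injf injg] injg'] := (homo_ltn_inj incf, homo_ltn_inj incg, homo_ltn_inj incg').
have nzD := vd_minor_neq0 injf injg; have nzD' := vd_minor_neq0 injf injg'.
set M := mxsub f g A in nzD *; set M' := mxsub f g' A in nzD' *.
apply: sgr_eq_of_nlt0 => // neg.
pose a : 'cV[R]_r := rowsub f (col (g k) A).
pose c : 'cV[R]_r := \adj M' *m a.
have ck : c k 0 = \det M.
  rewrite mxE (expand_det_col M k); apply: eq_bigr => i _; rewrite !mxE mulrC.
  congr (_ * _); apply: cofactor_col_irrelevant => j l ne_lk.
  by rewrite !mxE eqg.
pose x : 'cV[R]_n := \det M' *: delta_mx (g k) 0 - colsub g' 1%:M *m c.
have gkN t : g k != g' t.
  apply/eqP => Et; have [tk|ntk] := eqVneq t k.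
    by rewrite Et tk ltnn in ltk.
  by move: Et; rewrite -(eqg _ ntk) => /injg kt; rewrite kt eqxx in ntk.
have xE i : x i 0 = \det M' *+ (i == g k) - (colsub g' 1%:M *m c) i 0.
  by rewrite !mxE eqxx andbT mulr_natr.
have xgk : x (g k) 0 = \det M'.
  rewrite xE eqxx mulr1n; have [->|/colsub1_mulmx_out[t /eqP]] :=
    eqVneq ((colsub g' 1%:M *m c) (g k) 0) 0; first by rewrite subr0.
  by rewrite (negPf (gkN t)).
have xg'k : x (g' k) 0 = - \det M.
  by rewrite xE eq_sym (negPf (gkN k)) colsub1_mulmx_in // ck sub0r.
have supp i : x i 0 != 0 -> i = g k \/ exists t, i = g' t.
  rewrite xE; have [->|_] := eqVneq i (g k); first by left.
  by rewrite sub0r oppr_eq0 => /colsub1_mulmx_out; right.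
have nzx : x != 0 by apply: contra nzD' => /eqP x0; rewrite -xgk x0 mxE.
have Axf t : (A *m x) (f t) 0 = 0.
  have : rowsub f (A *m x) = 0.
    rewrite mulmxBr mulmx_colsub1 -scalemxAr -colE.
    have -> : rowsub f (\det M' *: col (g k) A - colsub g' A *m c) =
              \det M' *: a - M' *m c.
      by apply/colP => i; rewrite !mxE; congr (_ - _); apply: eq_bigr => j _; rewrite !mxE.
    by rewrite mulmxA mul_mx_adj mul_scalar_mx subrr.
  by move/colP/(_ t); rewrite !mxE.
have := vdA nzx; rewrite leqNgt => /negP; apply.
apply: leq_trans (S_plus_ge_zeros injf Axf).
have [b [s [[nzs bs] mono_b hit_b le_b]]] := S_minus_blocks nzx.
have nzg : x (g k) 0 != 0 by rewrite xgk.
have nzg' : x (g' k) 0 != 0 by rewrite xg'k oppr_eq0.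
have same_parity : odd (b (g k)) = odd (b (g' k)).
  have : 0 < x (g k) 0 * x (g' k) 0 by rewrite xgk xg'k mulrN oppr_gt0 mulrC.
  rewrite (bs (g k)) (bs (g' k)) -[_ ^+ b (g k)]signr_odd -[_ ^+ b (g' k)]signr_odd.
  case: (odd _); case: (odd _) => //; rewrite expr0 expr1 ?mulr1 ?mulrN1 !mulNr ?mulrN;
  by rewrite oppr_gt0 mulrACA -expr2 ltNge mulr_ge0 ?sqr_ge0 ?mulr_ge0 ?normr_ge0.
(* With equal parities, distinct run numbers would differ by at least 2, and some support index
   would lie in the run just after that of [g' k]. But every other support index is below [g' k] or
   above [g k]. *)
have eq_b : b (g k) = b (g' k).
  have := mono_b _ _ nzg' nzg (ltnW ltk); rewrite leq_eqVlt => /predU1P[//|lt_b].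
  have lt_b1 : ((b (g' k)).+1 < b (g k))%N.
    rewrite ltn_neqAle lt_b andbT; apply/eqP => eq_b.
    by move: same_parity; rewrite -eq_b /=; case: odd.
  have [i nzi bi] := hit_b _ (leq_trans (ltnW lt_b1) (le_b _ nzg)).
  have [Ei|[j Ei]] := supp i nzi; first by rewrite -Ei bi ltnn in lt_b1.
  have [le_jk|lt_kj] := leqP j k.
    have : (i <= g' k)%N.
      rewrite Ei; move: le_jk; rewrite leq_eqVlt => /predU1P[/val_inj->//|].
      by move/incg'/ltnW.
    by move/(mono_b _ _ nzi nzg'); rewrite bi ltnn.
  have /ltnW/(mono_b _ _ nzg nzi) : (g k < i)%N.
    by rewrite Ei -eqg ?incg //; apply: contraTneq lt_kj => ->; rewrite ltnn.
  by rewrite bi leqNgt lt_b1.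
(* As [g k] shares the run of [g' k], the [r] columns [g'] already meet every run. *)
apply: (@covered_ltn _ _ (b \o g')) => t /hit_b[i /supp[->|[j ->]] <-].
  by exists k.
by exists j.
Qed.

End VDToSSR.

Theorem theoremA (R : realType) (m n : nat) (hm : (1 <= m)%N) (hn : (1 <= n)%N)
    (A : 'M[R]_(m, n)) :
  (forall x : 'cV[R]_n, x <> 0 -> (S_plus (A *m x) <= S_minus x)%N) <->
  strictly_sign_regular A.
Proof.
split; last exact: ssr_variation_diminishing.
case: m n hm hn A => [//|m] [//|n] _ _ A vdA.
have {}vdA x : x != 0 -> (S_plus (A *m x) <= S_minus x)%N by move/eqP/vdA.
(* The sign for order [r] is read off the minor on the first [r] rows and columns. *)
pose f0 r d (t : 'I_r) : 'I_d.+1 := inord t.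
exists (fun r => Num.sg (\det (mxsub (@f0 r m) (@f0 r n) A))) => r.
rewrite leq_min => /andP[_ /andP[le_rm le_rn]].
have inc0 d : (r <= d.+1)%N -> {homo @f0 r d : i j / (i < j)%N}.
  by move=> le_rd i j; rewrite /f0 !inordK // (leq_trans (ltn_ord _)).
split=> [|f g incf incg].
  have : \det (mxsub (@f0 r m) (@f0 r n) A) != 0.
    by apply: vd_minor_neq0 => //; apply/homo_ltn_inj/inc0.
  by case: sgrP => // _ _; [left | right].
split; first by apply: vd_minor_neq0 => //; apply: homo_ltn_inj.
(* The rows descend first with the columns [g] fixed, then the columns descend with the initial
   rows. *)
rewrite (@descend_to_initial m r _ (fun f => Num.sg (\det (mxsub f g A)))) //.
- rewrite (@descend_to_initial n r _
    (fun g => Num.sg (\det (mxsub (fun t => inord t) g A)))) //.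
  + by move=> g1 g2 Eg; congr (Num.sg (\det _)); apply/matrixP => i j; rewrite !mxE Eg.
  + by move=> g1 g2 k inc1 inc2; apply: vd_col_step => //; apply: inc0.
- by move=> f1 f2 Ef; congr (Num.sg (\det _)); apply/matrixP => i j; rewrite !mxE Ef.
- by move=> f1 f2 k inc1 inc2; apply: vd_row_step.
Qed.
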